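(* For every integer $k\geq1$ there is a constant $c_k>0$ such that for every finite set $A\subset\mathbb{C}$, $$|4^{k-1}A^{(k)}|\geq c_k|A|^k.$$
   Context: For a finite set $X\subset\mathbb{C}$ and an integer $m\ge1$, $mX:=\{x_1+\cdots+x_m: x_1,\dots,x_m\in X\}$ is the $m$-fold sum set and $X^{(m)}:=\{x_1\cdots x_m: x_1,\dots,x_m\in X\}$ the $m$-fold product set. Thus $4^{k-1}A^{(k)}$ is the $4^{k-1}$-fold sum set of the $k$-fold product set of $A$. *)

(* Defs.v *)
From Stdlib Require Import Reals List.
Open Scope R_scope.

Definition Cpx : Type := (R * R)%type.
Definition C0 : Cpx := (0, 0).
Definition C1 : Cpx := (1, 0).
Definition Cadd (z w : Cpx) : Cpx := (fst z + fst w, snd z + snd w).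
Definition Cmul (z w : Cpx) : Cpx :=
  (fst z * fst w - snd z * snd w, fst z * snd w + snd z * fst w).

Fixpoint in_sumset (m : nat) (X : Cpx -> Prop) (z : Cpx) : Prop :=
  match m with
  | O => z = C0
  | S m' => exists x y, X x /\ in_sumset m' X y /\ z = Cadd x y
  end.

Fixpoint in_prodset (m : nat) (X : Cpx -> Prop) (z : Cpx) : Prop :=
  match m with
  | O => z = C1
  | S m' => exists x y, X x /\ in_prodset m' X y /\ z = Cmul x y
  end.

(* Main.v *)
Require Import Defs.
From Stdlib Require Import Reals List.
From Stdlib Require Import Lra Lia Classical IndefiniteDescription FinFun.
From Coquelicot Require Import Complex.
Import ListNotations.
Open Scope R_scope.

(** It suffices to gain a factor [|A|] at each step, i.e. to prove
    [|A| |D| <= 8 |AD + AD + AD + AD|] when all elements of [A] are nonzero and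
    within 45 degrees of each other, and likewise for [D]; the pigeonhole
    principle over octants restores this condition at each step.
    Associate with each slope [l] of a finite set [B / B] its nearest other slope
    [l'].  If [(u, l u)] and [(v, l' v)] are vectors on the two lines with an
    angle at most 90 degrees between [u] and [v], then the slope [w] of their sum
    is closer to [l] than [l'] is.  Any [w] has this property for at most one [l]
    per octant around [w], so vector sums taken over all [l] are at most 8-to-1.
    Applied to the points of [A x A], this gives [|A|^2 <= 8 |(A+A)/(A+A)|];
    applied to [B = A + A] and the points [(x c, y c)] with [c] in [D] and one
    [(x, y)] in [B x B] per slope, it gives
    [|(A+A)/(A+A)| |D|^2 <= 8 |(A+A)D + (A+A)D|^2]. *)

(** * Counting, choice and pigeonhole for finite lists *)

Lemma inj_on_length {X Y : Type} (f : X -> Y) (l : list X) (m : list Y) :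
  NoDup l -> (forall x, In x l -> In (f x) m) ->
  (forall x y, In x l -> In y l -> f x = f y -> x = y) ->
  (length l <= length m)%nat.
Proof.
  intros Hl Hm Hinj.
  rewrite <- (length_map f).
  apply NoDup_incl_length.
  - induction Hl as [|x l Hx Hl IH]; simpl; constructor.
    + intros H. apply in_map_iff in H. destruct H as [y [Hy Hyl]].
      apply Hx. replace x with y; [exact Hyl|].
      apply Hinj; simpl; auto.
    + apply IH; intros; [apply Hm | apply Hinj]; simpl; auto.
  - intros y Hy. apply in_map_iff in Hy. destruct Hy as [x [<- Hx]]. auto.
Qed.

Lemma NoDup_list_prod {X Y : Type} (l : list X) (m : list Y) :
  NoDup l -> NoDup m -> NoDup (list_prod l m).
Proof.
  intros Hl Hm. induction Hl as [|x l Hx Hl IH]; simpl; [constructor|].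
  apply NoDup_app; [|exact IH|].
  - apply Injective_map_NoDup; [|exact Hm].
    intros y z H. congruence.
  - intros [a b] H H'. apply in_map_iff in H. destruct H as [y [E _]].
    apply in_prod_iff in H'. inversion E; subst. tauto.
Qed.

(** [functional_choice] asks for a total relation, so [y0] is the value taken outside [l]. *)
Lemma choice_on {X Y : Type} (l : list X) (P : X -> Y -> Prop) (y0 : Y) :
  (forall x, In x l -> exists y, P x y) ->
  exists f, forall x, In x l -> P x (f x).
Proof.
  intros H. apply (functional_choice (fun x y => In x l -> P x y)).
  intros x. destruct (classic (In x l)) as [Hx|Hx].
  - destruct (H x Hx) as [y Hy]. exists y. auto.
  - exists y0. tauto.
Qed.

Lemma exists_argmin {X : Type} (g : X -> R) (P : X -> Prop) (l : list X) :
  (exists x, In x l /\ P x) ->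
  exists x, In x l /\ P x /\ forall y, In y l -> P y -> g x <= g y.
Proof.
  induction l as [|a l IH]; intros [x [Hx Px]]; [destruct Hx|].
  destruct (classic (exists x, In x l /\ P x)) as [H|H].
  - destruct (IH H) as [z [Hz [Pz Hmin]]].
    destruct (classic (P a /\ g a <= g z)) as [[Pa Ha]|Ha].
    + exists a. split; [simpl; auto|]. split; [exact Pa|].
      intros y [<-|Hy] Py; [lra|]. specialize (Hmin y Hy Py). lra.
    + exists z. split; [simpl; auto|]. split; [exact Pz|].
      intros y [<-|Hy] Py; [|auto].
      destruct (Rle_or_lt (g a) (g z)); [tauto|lra].
  - destruct Hx as [<-|Hx]; [|exfalso; eauto].
    exists a. split; [simpl; auto|]. split; [exact Px|].
    intros y [<-|Hy] Py; [lra|exfalso; eauto].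
Qed.

Lemma majority {X : Type} (p : X -> bool) (l : list X) : NoDup l ->
  exists b m, NoDup m /\ (forall x, In x m -> In x l /\ p x = b) /\
    (length l <= 2 * length m)%nat.
Proof.
  intros Hl. pose proof (filter_length p l) as E.
  destruct (Nat.le_gt_cases (length (filter (fun x => negb (p x)) l))
                            (length (filter p l))).
  - exists true, (filter p l). split; [apply NoDup_filter, Hl|]. split; [|lia].
    intros x Hx. apply filter_In, Hx.
  - exists false, (filter (fun x => negb (p x)) l).
    split; [apply NoDup_filter, Hl|]. split; [|lia].
    intros x Hx. apply filter_In in Hx. rewrite Bool.negb_true_iff in Hx. exact Hx.
Qed.

(** * Angles and lengths in the complex plane *)

Definition Ceq_dec (z w : C) : {z = w} + {z <> w}.
Proof.
  destruct z as [a b], w as [c d].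
  destruct (Req_dec_T a c) as [->|H]; [destruct (Req_dec_T b d) as [->|H]|];
    [left | right | right]; congruence.
Defined.

Definition sqnorm (z : C) : R := fst z ^ 2 + snd z ^ 2.
Definition dot (z w : C) : R := fst z * fst w + snd z * snd w.
Definition det (z w : C) : R := snd z * fst w - fst z * snd w.

(** The argument of [z / w] is at most 45 degrees: [dot z w] and [det z w] are the
    real and imaginary parts of [z] times the conjugate of [w]. *)
Definition close (z w : C) : Prop := - dot z w <= det z w <= dot z w.

Lemma sqnorm_mult (z w : C) : sqnorm (z * w)%C = sqnorm z * sqnorm w.
Proof. unfold sqnorm, Cmult; simpl; ring. Qed.

Lemma sqnorm_pos (z : C) : z <> 0%C -> 0 < sqnorm z.
Proof.
  intros H. unfold sqnorm. destruct z as [a b]; simpl.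
  destruct (Rlt_or_le 0 (a ^ 2 + b ^ 2)) as [|Hle]; [simpl in *; lra|].
  exfalso. apply H. assert (a = 0) by nra. assert (b = 0) by nra.
  subst. reflexivity.
Qed.

Lemma sqnorm_sub_sym (z w : C) : sqnorm (z - w)%C = sqnorm (w - z)%C.
Proof. unfold sqnorm, Cminus, Cplus, Copp; simpl; ring. Qed.

(** [dot] and [det] are bilinear, so the inequalities defining [close] add up over the four
    pairs. *)
Lemma close_add (a b c d : C) :
  close a c -> close a d -> close b c -> close b d -> close (a + b)%C (c + d)%C.
Proof. unfold close, dot, det, Cplus; simpl; lra. Qed.

(** At an angle of at most 45 degrees, [dot z w] is at least [|z| |w| / sqrt 2], so [2 * dot z w] is
    at least the smaller of the squared lengths; the law of cosines then leaves at most the larger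
    one. *)
Lemma close_sub (z w : C) :
  close z w -> sqnorm (z - w)%C <= sqnorm z \/ sqnorm (z - w)%C <= sqnorm w.
Proof.
  intros [H1 H2].
  assert (E : sqnorm (z - w)%C = sqnorm z + sqnorm w - 2 * dot z w)
    by (unfold sqnorm, dot, Cminus, Cplus, Copp; simpl; ring).
  assert (L : dot z w ^ 2 + det z w ^ 2 = sqnorm z * sqnorm w)
    by (unfold sqnorm, dot, det; simpl; ring).
  assert (Hz : 0 <= sqnorm z) by (unfold sqnorm; nra).
  assert (Hw : 0 <= sqnorm w) by (unfold sqnorm; nra).
  assert (D : det z w ^ 2 <= dot z w ^ 2) by nra.
  rewrite E. destruct (Rle_or_lt (sqnorm z) (sqnorm w)); [right|left]; nra.
Qed.

(** Arguments add under multiplication: two angles of at most 45 degrees give one of at most 90. *)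
Lemma dot_mult_close (a c b d : C) :
  close a c -> close b d -> 0 <= dot (a * b)%C (c * d)%C.
Proof.
  intros [] [].
  replace (dot (a * b)%C (c * d)%C) with (dot a c * dot b d - det a c * det b d)
    by (unfold dot, det, Cmult; simpl; ring).
  nra.
Qed.

Lemma sqnorm_add_lt (u v : C) : u <> 0%C -> 0 <= dot u v -> sqnorm v < sqnorm (u + v)%C.
Proof.
  intros Hu Hd. apply sqnorm_pos in Hu.
  replace (sqnorm (u + v)%C) with (sqnorm u + sqnorm v + 2 * dot u v)
    by (unfold sqnorm, dot, Cplus; simpl; ring).
  lra.
Qed.

Lemma add_neq_0 (u v : C) : u <> 0%C -> 0 <= dot u v -> (u + v)%C <> 0%C.
Proof.
  intros Hu Hd E. pose proof (sqnorm_add_lt u v Hu Hd) as H. rewrite E in H.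
  unfold sqnorm in H; simpl in H. nra.
Qed.

Lemma close_dot (z w : C) : close z w -> 0 <= dot z w.
Proof. unfold close; lra. Qed.

(** * Octants and narrow sets *)

Definition Rleb (x y : R) : bool := if Rle_dec x y then true else false.

Definition octant (z : C) : bool * bool * bool :=
  (Rleb 0 (fst z), Rleb 0 (snd z), Rleb (Rabs (snd z)) (Rabs (fst z))).

Lemma octant_close (z w : C) : octant z = octant w -> close z w.
Proof.
  unfold octant, Rleb, close, dot, det. destruct z as [a b], w as [c d]; simpl.
  intros H.
  destruct (Rle_dec 0 a), (Rle_dec 0 c); try discriminate;
  destruct (Rle_dec 0 b), (Rle_dec 0 d); try discriminate;
  destruct (Rle_dec (Rabs b) (Rabs a)) as [?|?],
           (Rle_dec (Rabs d) (Rabs c)) as [?|?]; try discriminate;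
  clear H; unfold Rabs in *;
  repeat match goal with H : context [Rcase_abs ?x] |- _ => destruct (Rcase_abs x) end;
  try lra; nra.
Qed.

Definition octants : list (bool * bool * bool) :=
  list_prod (list_prod [true; false] [true; false]) [true; false].

Lemma in_octants (z : C) : In (octant z) octants.
Proof.
  destruct (octant z) as [[[] []] []]; simpl; tauto.
Qed.

Definition narrow (l : list C) : Prop :=
  NoDup l /\ (forall x, In x l -> x <> 0%C) /\
  (forall x y, In x l -> In y l -> close x y).

(** Each of the three bits of [octant] costs a factor 2 by [majority], and what remains lies in a
    single octant. *)
Lemma exists_narrow (l : list C) : NoDup l -> (forall x, In x l -> x <> 0%C) ->
  exists m, narrow m /\ incl m l /\ (length l <= 8 * length m)%nat.
Proof.
  intros Hl H0.
  destruct (majority (fun z : C => Rleb 0 (fst z)) l Hl) as [b1 [l1 [N1 [I1 H1]]]].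
  destruct (majority (fun z : C => Rleb 0 (snd z)) l1 N1) as [b2 [l2 [N2 [I2 H2]]]].
  destruct (majority (fun z : C => Rleb (Rabs (snd z)) (Rabs (fst z))) l2 N2)
    as [b3 [l3 [N3 [I3 H3]]]].
  assert (Hin : forall x, In x l3 -> In x l /\ octant x = (b1, b2, b3)).
  { intros x Hx. destruct (I3 x Hx) as [Hx2 E3]. destruct (I2 x Hx2) as [Hx1 E2].
    destruct (I1 x Hx1) as [Hx0 E1]. split; [exact Hx0|].
    unfold octant. congruence. }
  exists l3. split; [split; [exact N3|split]|split; [|lia]].
  - intros x Hx. apply H0, Hin, Hx.
  - intros x y Hx Hy. apply octant_close.
    destruct (Hin x Hx), (Hin y Hy). congruence.
  - intros x Hx. apply Hin, Hx.
Qed.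

(** * Nearest neighbours and mediants *)

Definition nearest (L : list C) (nn : C -> C) : Prop :=
  forall p, In p L -> In (nn p) L /\ nn p <> p /\
    forall q : C, In q L -> q <> p -> sqnorm (nn p - p)%C <= sqnorm (q - p)%C.

Lemma exists_nearest (L : list C) (p q : C) :
  In p L -> In q L -> p <> q -> exists nn, nearest L nn.
Proof.
  intros Hp Hq Hpq. apply (choice_on L (fun p n : C => In n L /\ n <> p /\
    forall q : C, In q L -> q <> p -> sqnorm (n - p)%C <= sqnorm (q - p)%C) 0%C).
  intros x Hx.
  apply (exists_argmin (fun n : C => sqnorm (n - x)%C) (fun n => n <> x) L).
  destruct (classic (p = x)) as [->|]; eauto.
Qed.

(** Two points of [L] seen from [w] in the same octant are at distance at most
    the larger of their distances to [w], so they cannot both be farther from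
    their nearest neighbours than from [w]. *)
Lemma nearest_octant_inj (L : list C) (nn : C -> C) (p q w : C) :
  nearest L nn -> In p L -> In q L ->
  sqnorm (w - p)%C < sqnorm (nn p - p)%C ->
  sqnorm (w - q)%C < sqnorm (nn q - q)%C ->
  octant (w - p)%C = octant (w - q)%C -> p = q.
Proof.
  intros HN Hp Hq Hwp Hwq Ho. apply NNPP. intros Hpq.
  destruct (HN p Hp) as [_ [_ Mp]]. destruct (HN q Hq) as [_ [_ Mq]].
  specialize (Mp q Hq (not_eq_sym Hpq)). specialize (Mq p Hp Hpq).
  pose proof (close_sub _ _ (octant_close _ _ Ho)) as Hc.
  replace (w - p - (w - q))%C with (q - p)%C in Hc by ring.
  rewrite (sqnorm_sub_sym p q) in Mq. lra.
Qed.

(** With [w] the mediant, [(u + v) * (w - l) = (l' - l) * v], and [v] is strictly shorter than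
    [u + v] because the angle between [u] and [v] is at most 90 degrees. *)
Lemma mediant_near (l l' u v : C) :
  l <> l' -> u <> 0%C -> 0 <= dot u v ->
  sqnorm ((l * u + l' * v) / (u + v) - l)%C < sqnorm (l' - l)%C.
Proof.
  intros Hl Hu Hd.
  pose proof (sqnorm_add_lt u v Hu Hd) as Hlt.
  pose proof (add_neq_0 u v Hu Hd) as Hn.
  set (w := ((l * u + l' * v) / (u + v))%C).
  assert (E : ((u + v) * (w - l) = (l' - l) * v)%C) by (unfold w; field; exact Hn).
  apply (f_equal sqnorm) in E. rewrite !sqnorm_mult in E.
  assert (P : 0 < sqnorm (l' - l)%C).
  { apply sqnorm_pos. intros H. apply Hl.
    replace l with (l' - (l' - l))%C by ring. rewrite H. ring. }
  assert (0 <= sqnorm v) by (unfold sqnorm; nra).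
  nra.
Qed.

(** * Slopes, and the quotients of a sum set *)

Definition slopes (B : list C) : list C :=
  nodup Ceq_dec (map (fun p => (snd p / fst p)%C) (list_prod B B)).

Lemma in_slopes (B : list C) (l : C) : In l (slopes B) <->
  exists x y, In x B /\ In y B /\ l = (y / x)%C.
Proof.
  unfold slopes. rewrite nodup_In, in_map_iff. split.
  - intros [[x y] [E H]]. apply in_prod_iff in H. simpl in E.
    exists x, y. intuition.
  - intros [x [y [Hx [Hy ->]]]]. exists (x, y). split; [reflexivity|].
    apply in_prod; auto.
Qed.

(** Picks one point [(X l, l * X l)] of [B x B] on each line of slope [l]. *)
Lemma exists_repr (B : list C) : (forall x, In x B -> x <> 0%C) ->
  exists X : C -> C, forall l, In l (slopes B) -> In (X l) B /\ In (l * X l)%C B.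
Proof.
  intros H0. apply (choice_on (slopes B) (fun l x : C => In x B /\ In (l * x)%C B) 0%C).
  intros l Hl. apply in_slopes in Hl. destruct Hl as [x [y [Hx [Hy ->]]]].
  exists x. split; [exact Hx|].
  replace (y / x * x)%C with y by (field; auto). exact Hy.
Qed.

Definition sums (A : list C) : list C :=
  nodup Ceq_dec (map (fun p => (fst p + snd p)%C) (list_prod A A)).

Lemma in_sums (A : list C) (x : C) : In x (sums A) <-> exists a b, In a A /\ In b A /\ x = (a + b)%C.
Proof.
  unfold sums. rewrite nodup_In, in_map_iff. split.
  - intros [[a b] [E H]]. apply in_prod_iff in H. simpl in E. exists a, b. intuition.
  - intros [a [b [Ha [Hb ->]]]]. exists (a, b). split; [reflexivity|]. apply in_prod; auto.
Qed.

Lemma narrow_sums (A : list C) : narrow A -> narrow (sums A).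
Proof.
  intros [_ [H0 Hc]]. split; [apply NoDup_nodup|split].
  - intros x Hx. apply in_sums in Hx. destruct Hx as [a [b [Ha [Hb ->]]]].
    apply add_neq_0; auto. apply close_dot; auto.
  - intros x y Hx Hy. apply in_sums in Hx, Hy.
    destruct Hx as [a [b [Ha [Hb ->]]]], Hy as [c [d [Hc' [Hd ->]]]].
    apply close_add; auto.
Qed.

(** Each point of [A x A] is added to the chosen point on the nearest other line. The slope of the
    sum, together with the octant in which it is seen from the original slope, determines the point.
    The distinct [p] and [q] ensure that there are two slopes. *)
Lemma card_slopes_sums (A : list C) (p q : C) : narrow A -> In p A -> In q A -> p <> q ->
  (length A * length A <= 8 * length (slopes (sums A)))%nat.
Proof.
  intros [Hnd [H0 Hc]] Hp Hq Hpq.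
  destruct (exists_repr A H0) as [X HX].
  destruct (exists_nearest (slopes A) (p / p)%C (q / p)%C) as [nn Hnn].
  { apply in_slopes; exists p, p; auto. }
  { apply in_slopes; exists p, q; auto. }
  { intros E. apply Hpq.
    replace p with (p / p * p)%C by (field; auto). rewrite E. field; auto. }
  (* The slope of [(a, l * a)] plus the chosen point on the line of slope [nn l]. *)
  pose (m := fun l a : C => ((l * a + nn l * X (nn l)) / (a + X (nn l)))%C).
  pose (f := fun s : C * C => let l := (snd s / fst s)%C in
                (m l (fst s), octant (m l (fst s) - l)%C)).
  transitivity (length (list_prod (slopes (sums A)) octants));
    [rewrite <- (length_prod A A) | rewrite length_prod; simpl; lia].
  apply (inj_on_length f).
  - apply NoDup_list_prod; auto.
  - intros [a b] H. apply in_prod_iff in H. destruct H as [Ha Hb].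
    unfold f; cbn [fst snd].
    assert (Hl : In (b / a)%C (slopes A)) by (apply in_slopes; exists a, b; auto).
    destruct (Hnn _ Hl) as [Hl' _]. destruct (HX _ Hl') as [Hx Hy].
    apply in_prod; [|apply in_octants].
    apply in_slopes. exists (a + X (nn (b / a)))%C, (b + nn (b / a) * X (nn (b / a)))%C.
    split; [apply in_sums; eauto|]. split; [apply in_sums; eauto|].
    unfold m. cbn [fst snd]. replace (b / a * a)%C with b by (field; auto). reflexivity.
  - intros [a b] [a' b'] H H'. apply in_prod_iff in H, H'.
    destruct H as [Ha Hb], H' as [Ha' Hb']. unfold f; cbn [fst snd]. intros E.
    apply pair_equal_spec in E. destruct E as [Em Eo].
    assert (Hl : In (b / a)%C (slopes A)) by (apply in_slopes; exists a, b; auto).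
    assert (Hl' : In (b' / a')%C (slopes A)) by (apply in_slopes; exists a', b'; auto).
    assert (Near : forall l c, In l (slopes A) -> In c A ->
              sqnorm (m l c - l)%C < sqnorm (nn l - l)%C).
    { intros l c H1 H2. destruct (Hnn l H1) as [H3 [H4 _]].
      apply mediant_near; auto. apply close_dot, Hc; auto. apply HX; auto. }
    assert (El : (b / a = b' / a')%C).
    { apply (nearest_octant_inj (slopes A) nn _ _ (m (b / a)%C a)); auto.
      - rewrite Em. auto.
      - rewrite Eo, Em. reflexivity. }
    (* For fixed [l], the map from [a] to [m l a] is a Moebius transformation of determinant
       [(l - nn l) * x], which is nonzero; cross-multiplying shows its injectivity. *)
    assert (Ea : a = a').
    { rewrite <- El in Em. set (l := (b / a)%C) in *.
      destruct (Hnn l Hl) as [H1 [H2 _]]. destruct (HX _ H1) as [H3 _].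
      set (x := X (nn l)) in *.
      assert (N1 : (a + x)%C <> 0%C) by (apply add_neq_0; auto; apply close_dot; auto).
      assert (N2 : (a' + x)%C <> 0%C) by (apply add_neq_0; auto; apply close_dot; auto).
      unfold m in Em. fold x in Em.
      assert (F : ((l * a + nn l * x) * (a' + x) = (l * a' + nn l * x) * (a + x))%C).
      { replace (l * a + nn l * x)%C
          with ((l * a + nn l * x) / (a + x) * (a + x))%C by (field; auto).
        rewrite Em. field; auto. }
      assert (G : ((a' - a) * ((nn l - l) * x) = 0)%C).
      { replace ((a' - a) * ((nn l - l) * x))%C with
          ((l * a + nn l * x) * (a' + x) - (l * a' + nn l * x) * (a + x))%C by ring.
        rewrite F. ring. }
      destruct (classic (a = a')) as [|Hne]; [auto|exfalso].
      revert G. apply Cmult_neq_0; [|apply Cmult_neq_0; auto];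
        intros Z; [apply Hne|apply H2].
      - replace a' with (a + (a' - a))%C by ring. rewrite Z. ring.
      - replace (nn l) with (l + (nn l - l))%C by ring. rewrite Z. ring. }
    subst a'. f_equal.
    replace b with (b / a * a)%C by (field; auto). rewrite El. field; auto.
Qed.

(** * Gaining a factor [|A|] from sums of two products *)

Definition sumprods (B D : list C) : list C :=
  nodup Ceq_dec (map (fun p => (fst (fst p) * snd (fst p) + fst (snd p) * snd (snd p))%C)
    (list_prod (list_prod B D) (list_prod B D))).

Lemma in_sumprods (B D : list C) (z : C) : In z (sumprods B D) <->
  exists x c y d, In x B /\ In c D /\ In y B /\ In d D /\ z = (x * c + y * d)%C.
Proof.
  unfold sumprods. rewrite nodup_In, in_map_iff. split.
  - intros [[[x c] [y d]] [E H]]. rewrite !in_prod_iff in H. simpl in E.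
    exists x, c, y, d. intuition.
  - intros [x [c [y [d [Hx [Hc [Hy [Hd ->]]]]]]]]. exists ((x, c), (y, d)).
    split; [reflexivity|]. rewrite !in_prod_iff. auto.
Qed.

(** For each slope [l] and each [(c, d)] in [D x D], take [c] times the chosen vector of slope [l]
    plus [d] times that of slope [nn l]. The sum and an octant determine [l]; then [c] and [d]
    follow, as the two vectors are linearly independent. *)
Lemma card_slopes_sumprods (B D : list C) (p q : C) : narrow B -> narrow D ->
  In p (slopes B) -> In q (slopes B) -> p <> q ->
  (length (slopes B) * (length D * length D) <=
    8 * (length (sumprods B D) * length (sumprods B D)))%nat.
Proof.
  intros [_ [HB0 HBc]] [HDn [HD0 HDc]] Hp Hq Hpq.
  destruct (exists_repr (B : list C) HB0) as [X HX].
  destruct (exists_nearest (slopes B) p q Hp Hq Hpq) as [nn Hnn].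
  pose (S1 := fun l c d : C => (X l * c + X (nn l) * d)%C).
  pose (S2 := fun l c d : C => (l * X l * c + nn l * X (nn l) * d)%C).
  pose (f := fun s : C * (C * C) => let l := fst s in
    let c := fst (snd s) in let d := snd (snd s) in
    ((S1 l c d, S2 l c d), octant (S2 l c d / S1 l c d - l)%C)).
  rewrite <- !length_prod.
  transitivity (length (list_prod (list_prod (sumprods B D) (sumprods B D)) octants));
    [| rewrite length_prod; simpl length at 2; lia].
  apply (inj_on_length f).
  - apply NoDup_list_prod; [apply NoDup_nodup|apply NoDup_list_prod; auto].
  - intros [l [c d]] H. rewrite !in_prod_iff in H. destruct H as [Hl [Hc Hd]].
    destruct (Hnn l Hl) as [Hl' _]. destruct (HX _ Hl), (HX _ Hl').
    unfold f; cbn [fst snd]. apply in_prod; [apply in_prod|apply in_octants].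
    + apply in_sumprods. exists (X l), c, (X (nn l)), d. auto.
    + apply in_sumprods. exists (l * X l)%C, c, (nn l * X (nn l))%C, d. auto.
  - intros [l [c d]] [l' [c' d']] H H'. rewrite !in_prod_iff in H, H'.
    destruct H as [Hl [Hc Hd]], H' as [Hl' [Hc' Hd']].
    unfold f; cbn [fst snd]. intros E.
    rewrite !pair_equal_spec in E. destruct E as [[E1 E2] E3].
    assert (Near : forall l c d, In l (slopes B) -> In c D -> In d D ->
              sqnorm (S2 l c d / S1 l c d - l)%C < sqnorm (nn l - l)%C).
    { intros k a b H1 H2 H3. destruct (Hnn k H1) as [H4 [H5 _]].
      destruct (HX _ H1), (HX _ H4).
      (* The mediant of [l] and [nn l] with weights [u = X k * a] and [v = X (nn k) * b], here for
         [l = k]. *)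
      unfold S1, S2. rewrite <- !Cmult_assoc. apply mediant_near; auto.
      - apply Cmult_neq_0; auto.
      - apply dot_mult_close; auto. }
    assert (El : l = l').
    { apply (nearest_octant_inj (slopes B) nn _ _ (S2 l c d / S1 l c d)%C); auto.
      - rewrite E1, E2. auto.
      - rewrite E3, E1, E2. reflexivity. }
    subst l'. destruct (Hnn l Hl) as [Hn [Hne _]].
    destruct (HX _ Hl) as [HXl _], (HX _ Hn) as [HXn _].
    assert (Hdiff : (nn l - l)%C <> 0%C).
    { intros Z. apply Hne. replace (nn l) with (l + (nn l - l))%C by ring.
      rewrite Z. ring. }
    unfold S1 in E1. unfold S2 in E2.
    (* Subtracting the second coordinates from [nn l] times the first eliminates [d]. *)
    assert (Gc : (c' - c = 0)%C).
    { apply NNPP. intros Hcc.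
      assert (G : ((c' - c) * (X l * (nn l - l)) = 0)%C).
      { replace ((c' - c) * (X l * (nn l - l)))%C with
          (nn l * ((X l * c' + X (nn l) * d') - (X l * c + X (nn l) * d))
           - ((l * X l * c' + nn l * X (nn l) * d')
              - (l * X l * c + nn l * X (nn l) * d)))%C by ring.
        rewrite E1, E2. ring. }
      revert G. repeat apply Cmult_neq_0; auto. }
    assert (Ec : c = c').
    { replace c' with (c + (c' - c))%C by ring. rewrite Gc. ring. }
    subst c'.
    assert (Gd : (d' - d = 0)%C).
    { apply NNPP. intros Hdd.
      assert (G : ((d' - d) * X (nn l) = 0)%C).
      { replace ((d' - d) * X (nn l))%C with
          ((X l * c + X (nn l) * d') - (X l * c + X (nn l) * d))%C by ring.
        rewrite E1. ring. }
      revert G. apply Cmult_neq_0; auto. }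
    assert (Ed : d = d').
    { replace d' with (d + (d' - d))%C by ring. rewrite Gd. ring. }
    congruence.
Qed.

(** With [s] slopes of [A + A] and [P] sums of products, [|A|^2 <= 8 s] and [s |D|^2 <= 8 P^2]
    multiply to [(|A| |D|)^2 <= (8 P)^2]. *)
Lemma card_sumprods (A D : list C) : narrow A -> narrow D ->
  (length A * length D <= 8 * length (sumprods (sums A) D))%nat.
Proof.
  intros HA HD.
  destruct A as [|a A]; [simpl; lia|].
  assert (Ha : In a (a :: A)) by (simpl; auto).
  destruct A as [|b A].
  (* A singleton has only one slope, hence no nearest other one; here multiplication by [4 a] embeds
     [D]. *)
  - assert (length D <= length (sumprods (sums [a]) D))%nat; [|simpl length at 1; lia].
    destruct HA as [_ [H0 Hc]], HD as [HD _].
    assert (N : (a + a)%C <> 0%C) by (apply add_neq_0; auto; apply close_dot; auto).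
    assert (Haa : In (a + a)%C (sums [a])) by (apply in_sums; eauto).
    apply (inj_on_length (fun c : C => ((a + a) * c + (a + a) * c)%C)); auto.
    + intros c Hcc. apply in_sumprods. exists (a + a)%C, c, (a + a)%C, c. auto.
    + intros c d _ _ E. apply NNPP. intros Hcd.
      assert (G : ((a + a) * ((1 + 1) * (c - d)) = 0)%C).
      { replace ((a + a) * ((1 + 1) * (c - d)))%C with
          ((a + a) * c + (a + a) * c - ((a + a) * d + (a + a) * d))%C by ring.
        rewrite E. ring. }
      revert G. apply Cmult_neq_0; [exact N|]. apply Cmult_neq_0.
      * intros Z. apply (f_equal fst) in Z. simpl in Z. lra.
      * intros Z. apply Hcd. replace c with (d + (c - d))%C by ring. rewrite Z. ring.
  - remember (a :: b :: A) as A' eqn:EA.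
    assert (Hb : In b A') by (subst; simpl; auto).
    assert (Hab : a <> b).
    { destruct HA as [Hn _]. subst. inversion Hn. simpl in *. intuition congruence. }
    pose proof (narrow_sums A' HA) as HS.
    pose proof (card_slopes_sums A' a b HA Ha Hb Hab) as K1.
    destruct HA as [_ [H0 Hc]].
    assert (N : forall x, In x A' -> (x + x)%C <> 0%C)
      by (intros x Hx; apply add_neq_0; auto; apply close_dot; auto).
    assert (Hs : forall x, In x A' -> In (x + x)%C (sums A'))
      by (intros x Hx; apply in_sums; eauto).
    pose proof (card_slopes_sumprods (sums A') D
      ((a + a) / (a + a))%C ((b + b) / (a + a))%C HS HD) as K2.
    assert (K : (length (slopes (sums A')) * (length D * length D) <=
      8 * (length (sumprods (sums A') D) * length (sumprods (sums A') D)))%nat).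
    { apply K2;
        [ apply in_slopes; exists (a + a)%C, (a + a)%C; auto
        | apply in_slopes; exists (a + a)%C, (b + b)%C; auto |].
      intros E.
      assert (G : ((1 + 1) * (a - b) = 0)%C).
      { replace ((1 + 1) * (a - b))%C with ((a + a) / (a + a) * (a + a)
          - (b + b) / (a + a) * (a + a))%C by (field; auto).
        rewrite E. ring. }
      revert G. apply Cmult_neq_0.
      - intros Z. apply (f_equal fst) in Z. simpl in Z. lra.
      - intros Z. apply Hab. replace a with (b + (a - b))%C by ring. rewrite Z. ring. }
    clear K2. nia.
Qed.

(** The two products are nonzero and at most 90 degrees apart, so they cannot cancel. *)
Lemma sumprods_neq_0 (B D : list C) (z : C) : narrow B -> narrow D -> In z (sumprods B D) -> z <> 0%C.
Proof.
  intros [_ [HB HBc]] [_ [HD HDc]] Hz. apply in_sumprods in Hz.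
  destruct Hz as [x [c [y [d [Hx [Hc [Hy [Hd ->]]]]]]]].
  apply add_neq_0; [apply Cmult_neq_0; auto | apply dot_mult_close; auto].
Qed.

(** * Iterated sum and product sets, and the induction on [k] *)

Lemma in_sumset_add (X : Cpx -> Prop) (m n : nat) (x y : C) :
  in_sumset m X x -> in_sumset n X y -> in_sumset (m + n) X (x + y)%C.
Proof.
  revert x. induction m as [|m IH]; simpl; intros x Hx Hy.
  - subst. change C0 with (RtoC 0). rewrite Cplus_0_l. exact Hy.
  - destruct Hx as [a [b [Ha [Hb ->]]]]. exists a, (b + y)%C.
    split; [exact Ha|]. split; [auto|].
    change (a + b + y = a + (b + y))%C. ring.
Qed.

Lemma in_sumset_mult (m k : nat) (P : Cpx -> Prop) (a z : C) : P a ->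
  in_sumset m (in_prodset k P) z -> in_sumset m (in_prodset (S k) P) (a * z)%C.
Proof.
  intros Ha. revert z. induction m as [|m IH]; simpl; intros z Hz.
  - subst. change (a * 0 = 0)%C. ring.
  - destruct Hz as [x [y [Hx [Hy ->]]]]. exists (a * x)%C, (a * y)%C.
    split; [exists a, x; auto|]. split; [apply IH, Hy|].
    change (a * (x + y) = a * x + a * y)%C. ring.
Qed.

Lemma in_sumset_inhabited (m k : nat) (P : Cpx -> Prop) (a : Cpx) : P a ->
  exists z, in_sumset m (in_prodset k P) z.
Proof.
  intros Ha.
  assert (H : exists x, in_prodset k P x).
  { induction k as [|k [x Hx]]; simpl; [eauto|]. exists (Cmul a x), a, x. auto. }
  destruct H as [x Hx].
  induction m as [|m [z Hz]]; simpl; [eauto|]. exists (Cadd x z), x, z. auto.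
Qed.

(** Each step loses a factor 8 in [card_sumprods] and another 8 in making the new set narrow again,
    hence 64. *)
Lemma narrow_sumset_prodset (A : list C) (P : Cpx -> Prop) (k : nat) :
  narrow A -> (forall a, In a A -> P a) ->
  exists D, narrow D /\
    (forall z, In z D -> in_sumset (4 ^ k) (in_prodset (S k) P) z) /\
    (length A ^ S k <= 64 ^ k * length D)%nat.
Proof.
  intros HA HP. induction k as [|k [D [HD [HDin HDcard]]]].
  - exists A. split; [exact HA|]. split; [|simpl; lia].
    intros z Hz. simpl. exists z, C0. split; [|split; [reflexivity|]].
    + exists z, Defs.C1. split; [auto|]. split; [reflexivity|].
      change (z = z * 1)%C. ring.
    + change (z = z + 0)%C. ring.
  - pose proof (narrow_sums A HA) as HS.
    destruct (exists_narrow (sumprods (sums A) D)) as [E [HE [HEincl HEcard]]].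
    { apply NoDup_nodup. }
    { intros z. apply sumprods_neq_0; auto. }
    exists E. split; [exact HE|]. split.
    + intros z Hz. apply HEincl, in_sumprods in Hz.
      destruct Hz as [x [c [y [d [Hx [Hc [Hy [Hd ->]]]]]]]].
      apply in_sums in Hx, Hy.
      destruct Hx as [a1 [a2 [H1 [H2 ->]]]], Hy as [a3 [a4 [H3 [H4 ->]]]].
      (* Each of the four products is a [4 ^ k]-fold sum of products with one more factor, which
         accounts for [4 ^ S k]. *)
      replace ((a1 + a2) * c + (a3 + a4) * d)%C
        with ((a1 * c + a2 * c) + (a3 * d + a4 * d))%C by ring.
      replace (4 ^ S k)%nat with ((4 ^ k + 4 ^ k) + (4 ^ k + 4 ^ k))%nat by (simpl; lia).
      repeat apply in_sumset_add; apply in_sumset_mult; auto.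
    + pose proof (card_sumprods A D HA HD) as HK.
      change (length A ^ S (S k))%nat with (length A * length A ^ S k)%nat.
      change (64 ^ S k)%nat with (64 * 64 ^ k)%nat.
      transitivity (length A * (64 ^ k * length D))%nat;
        [apply Nat.mul_le_mono_l; exact HDcard|].
      transitivity (64 ^ k * (8 * (8 * length E)))%nat; [|lia].
      replace (length A * (64 ^ k * length D))%nat
        with (64 ^ k * (length A * length D))%nat by ring.
      apply Nat.mul_le_mono_l. lia.
Qed.

(* A finite set A of complex numbers is a duplicate-free list (|A| = length).
   |4^(k-1) A^(k)| >= c |A|^k is expressed as: the set 4^(k-1) A^(k) contains
   a duplicate-free list of length >= c |A|^k. *)
Theorem theorem5 :
  forall k : nat, (1 <= k)%nat ->
  exists c : R, 0 < c /\
    forall A : list Cpx, NoDup A ->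
      exists l : list Cpx,
        NoDup l /\
        (forall z, In z l ->
           in_sumset (4 ^ (k - 1))%nat (in_prodset k (fun x => In x A)) z) /\
        c * INR (length A) ^ k <= INR (length l).
Proof.
  intros [|k] Hk; [lia|]. clear Hk.
  replace (S k - 1)%nat with k by lia.
  (* Removing zero costs at most a factor 2 and restricting to an octant a factor 8, so 16 for each
     of the [S k] factors [|A|]; [64 ^ k] comes from the induction. *)
  set (M := (16 ^ S k * 64 ^ k)%nat).
  assert (HM : 0 < INR M).
  { apply lt_0_INR. unfold M. pose proof (Nat.pow_nonzero 16 (S k)).
    pose proof (Nat.pow_nonzero 64 k). nia. }
  exists (/ INR M). split; [apply Rinv_0_lt_compat, HM|].
  intros A HA.
  assert (Red : exists l, NoDup l /\
    (forall z, In z l -> in_sumset (4 ^ k) (in_prodset (S k) (fun x => In x A)) z) /\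
    (length A ^ S k <= M * length l)%nat).
  { set (nz := fun x : C => if Ceq_dec x 0%C then false else true).
    assert (Hnz : forall x, In x (filter nz A) <-> In x A /\ x <> 0%C).
    { intros x. rewrite filter_In. unfold nz.
      destruct (Ceq_dec x 0%C); intuition discriminate. }
    destruct (exists_narrow (filter nz A)) as [A' [HA' [Hincl Hcard]]].
    { apply NoDup_filter. exact HA. }
    { intros x Hx. apply Hnz, Hx. }
    (* If [A] is [{0}], nothing survives the removal of zero, so sizes 0 and 1 are treated directly;
       from size 2 on, at least half of [A] is nonzero. *)
    destruct (Nat.le_gt_cases (length A) 1) as [Hs|Hs].
    - destruct A as [|a A].
      + exists []. split; [constructor|]. split; [intros z []|]. simpl; lia.
      + destruct (in_sumset_inhabited (4 ^ k) (S k) (fun x => In x (a :: A)) a)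
          as [z Hz]; [simpl; auto|].
        exists [z]. split; [repeat constructor; auto|]. split.
        * intros w [<-|[]]. exact Hz.
        * replace (length (a :: A)) with 1%nat by (simpl in *; lia).
          rewrite Nat.pow_1_l. apply (INR_lt 0) in HM. simpl length. lia.
    - assert (Hrem : (length A <= S (length (filter nz A)))%nat).
      { change (S (length (filter nz A))) with (length (RtoC 0 :: filter nz A)).
        apply NoDup_incl_length; [exact HA|]. intros x Hx.
        destruct (Ceq_dec x 0%C) as [->|Hx0]; [simpl; auto|].
        right. apply Hnz. auto. }
      destruct (narrow_sumset_prodset A' (fun x => In x A) k HA') as [D [HD [HDin HDcard]]].
      { intros a Ha. apply Hnz, Hincl, Ha. }
      exists D. split; [apply HD|]. split; [exact HDin|].
      transitivity ((16 * length A') ^ S k)%nat; [apply Nat.pow_le_mono_l; lia|].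
      rewrite Nat.pow_mul_l. unfold M.
      rewrite <- Nat.mul_assoc. apply Nat.mul_le_mono_l. exact HDcard. }
  destruct Red as [l [Hl [Hin Hcard]]].
  exists l. split; [exact Hl|]. split; [exact Hin|].
  apply le_INR in Hcard. rewrite pow_INR, mult_INR in Hcard.
  apply (Rmult_le_reg_l (INR M)); [exact HM|].
  rewrite <- Rmult_assoc, Rinv_r, Rmult_1_l; [exact Hcard|lra].
Qed.
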